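(* Let $G$ and $H$ be abelian groups. There is no distributive law of PROPs $\tau:\mathbf{F}G;\mathbf{F}H\to\mathbf{F}H;\mathbf{F}G$ which gives rise to $\mathbf{IF}(G,H)$, i.e. such that the composite PROP $\mathbf{F}H;\mathbf{F}G$ determined by $\tau$ coincides (compatibly with the inclusions of $\mathbf{F}G$ and $\mathbf{F}H$) with $\mathbf{IF}(G,H)$.
   Context: A PROP is a strict symmetric monoidal category whose objects are the natural numbers with $\otimes$ given by addition on objects; a $\dagger$-PROP additionally has an identity-on-objects involutive contravariant functor $\dagger$ compatible with $\otimes$ and the symmetry. For PROPs $T_1,T_2$, a distributive law $\lambda:T_1;T_2\to T_2;T_1$ (in the sense of Lack, ''Composing PROPs'') is a rule rewriting each composable pair $n\xrightarrow{f_1}l\xrightarrow{f_2}m$ with $f_1\in T_1$, $f_2\in T_2$ into a pair $n\xrightarrow{f_2'}k\xrightarrow{f_1'}m$ with $f_2'\in T_2$, $f_1'\in T_1$, satisfying Lack's axioms; it yields a composite PROP $T_2;T_1$ whose morphisms are such pairs (first a $T_2$-morphism, then a $T_1$-morphism), presented by the generators and equations of $T_1+T_2$ together with the equations $f_2\circ f_1=f_1'\circ f_2'$ of $\lambda$. For an abelian group $G$, $\mathbf{F}G$ is the $\dagger$-PROP generated by $\mu:2\to1$, $\eta:0\to1$, $\delta:1\to2$, $\epsilon:1\to0$ and a morphism $g:1\to1$ for each $g\in G$, with $\mu^\dagger=\delta$, $\eta^\dagger=\epsilon$, $g^\dagger=g^{-1}$, subject to: $(\mu,\eta)$ commutative monoid,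 $(\delta,\epsilon)$ cocommutative comonoid, the Frobenius law $(\mu\otimes\mathrm{id}_1)(\mathrm{id}_1\otimes\delta)=\delta\mu=(\mathrm{id}_1\otimes\mu)(\delta\otimes\mathrm{id}_1)$, $\mu\delta=\mathrm{id}_1$, the group equations $g\circ g'=gg'$, $e=\mathrm{id}_1$, and $g\circ\mu=\mu\circ(g\otimes\mathrm{id}_1)$, $\delta\circ g=(g\otimes\mathrm{id}_1)\circ\delta$. $\mathbf{IF}(G,H)$ is the $\dagger$-PROP obtained from the coproduct $\mathbf{F}G+\mathbf{F}H$ (generators of $\mathbf{F}G$ written $\mu_g,\eta_g,\delta_g,\epsilon_g$, ''green''; of $\mathbf{F}H$ written $\mu_r,\eta_r,\delta_r,\epsilon_r$, ''red'') by imposing (B) the bialgebra laws $\delta_g\mu_r=(\mu_r\otimes\mu_r)(\mathrm{id}\otimes\sigma\otimes\mathrm{id})(\delta_g\otimes\delta_g)$, $\delta_g\eta_r=\eta_r\otimes\eta_r$, $\epsilon_g\mu_r=\epsilon_g\otimes\epsilon_g$ (with scalar factors built from $\epsilon_g\eta_r$ that are suppressed by convention; $\epsilon_g\eta_r=\mathrm{id}_0$ is not imposed), and (+) $\eta_r=(\epsilon_r\otimes\mathrm{id}_1)\circ\delta_g\circ\eta_g$ and $\epsilon_g=\epsilon_r\circ\mu_r\circ(\mathrm{id}_1\otimes\eta_g)$. *)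

(* Defs.v *)
From HB Require Import structures.
From mathcomp Require Import all_boot ssralg boolp.
From Corelib Require Import RelationClasses.

Set Implicit Arguments.
Unset Strict Implicit.
Unset Printing Implicit Defensive.

Import GRing.Theory.
Local Open Scope quotient_scope.

(* Transport of an arrow along equalities of its source and target; strict
   associativity and right unitality of the tensor only hold up to it, since
   [n + (m + k)] and [(n + m) + k] are not convertible. *)
Definition hcast (X : nat -> nat -> Type) n n' m m'
    (en : n = n') (em : m = m') (f : X n m) : X n' m' :=
  match en in _ = a, em in _ = b return X a b with
  | erefl, erefl => f
  end.

(** * Quotients by Prop-valued equivalence relations *)

Section Quotient.
Variables (T : Type) (R : T -> T -> Prop) (eqvR : Equivalence R).

Definition quot_rel (x y : {classic T}) : bool := `[< R x y >].

Lemma quot_refl : reflexive quot_rel.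
Proof. by move=> x; apply/asboolP; case: eqvR => r _ _; apply: r. Qed.
Lemma quot_sym : symmetric quot_rel.
Proof.
by move=> x y; apply: asbool_equiv_eq; case: eqvR => _ s _; split; apply: s.
Qed.
Lemma quot_trans : transitive quot_rel.
Proof.
move=> y x z /asboolP xy /asboolP yz; apply/asboolP.
by case: eqvR => _ _ t; apply: t xy yz.
Qed.

Canonical quot_equiv := EquivRel quot_rel quot_refl quot_sym quot_trans.

Definition quot : Type := {eq_quot quot_equiv}.
Definition qcls (x : T) : quot := \pi_({eq_quot quot_equiv}) (x : {classic T}).
Definition qrep (x : quot) : T := repr (x : {eq_quot quot_equiv}).

Lemma qrepK x : qcls (qrep x) = x.
Proof. exact: reprK. Qed.

Lemma qclsP x y : qcls x = qcls y <-> R x y.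
Proof.
split=> [/eqmodP /asboolP //|xy].
by apply/eqmodP; apply/asboolP.
Qed.

Lemma qrep_cls x : R (qrep (qcls x)) x.
Proof. by apply/qclsP; rewrite qrepK. Qed.

End Quotient.

(** * PROPs and dagger-PROPs *)

(* Composition is in diagrammatic order: [hcomp f g] is g o f.  Only one of the
   two hexagons is listed; the other one, and the unit coherence of [sym],
   follow from it and [symK]. *)
Record PROP := MkPROP {
  hom :> nat -> nat -> Type;
  idp : forall n, hom n n;
  hcomp : forall n m k, hom n m -> hom m k -> hom n k;
  tens : forall n m n' m', hom n m -> hom n' m' -> hom (n + n') (m + m');
  sym : forall n m, hom (n + m) (m + n);
  hcompA : forall n m k l (f : hom n m) (g : hom m k) (h : hom k l),
    hcomp f (hcomp g h) = hcomp (hcomp f g) h;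
  hcomp1f : forall n m (f : hom n m), hcomp (idp n) f = f;
  hcompf1 : forall n m (f : hom n m), hcomp f (idp m) = f;
  tens_id : forall n m, tens (idp n) (idp m) = idp (n + m);
  tens_comp : forall n m k n' m' k' (f : hom n m) (g : hom m k)
      (f' : hom n' m') (g' : hom m' k'),
    tens (hcomp f g) (hcomp f' g') = hcomp (tens f f') (tens g g');
  tensA : forall n m n' m' n'' m''
      (f : hom n m) (g : hom n' m') (h : hom n'' m''),
    hcast (addnA n n' n'') (addnA m m' m'') (tens f (tens g h)) =
    tens (tens f g) h;
  tens0f : forall n m (f : hom n m), tens (idp 0) f = f :> hom n m;
  tensf0 : forall n m (f : hom n m),
    hcast (addn0 n) (addn0 m) (tens f (idp 0)) = f;
  sym_nat : forall n m n' m' (f : hom n m) (g : hom n' m'),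
    hcomp (tens f g) (sym m m') = hcomp (sym n n') (tens g f);
  symK : forall n m, hcomp (sym n m) (sym m n) = idp (n + m);
  sym_hex : forall n m k,
    sym n (m + k) =
    hcomp (hcast (esym (addnA n m k)) (erefl _) (tens (sym n m) (idp k)))
         (hcast (addnA m n k) (addnA m k n) (tens (idp m) (sym n k)))
}.

Arguments idp {p} n.
Arguments sym {p} n m.

Record dPROP := MkdPROP {
  uPROP :> PROP;
  dag : forall n m, uPROP n m -> uPROP m n;
  dagK : forall n m (f : uPROP n m), dag (dag f) = f;
  dag_id : forall n, dag (idp n : uPROP n n) = idp n;
  dag_comp : forall n m k (f : uPROP n m) (g : uPROP m k),
    dag (hcomp f g) = hcomp (dag g) (dag f);
  dag_tens : forall n m n' m' (f : uPROP n m) (g : uPROP n' m'),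
    dag (tens f g) = tens (dag f) (dag g);
  dag_sym : forall n m, dag (sym n m : uPROP _ _) = sym m n
}.

Record PROPmor (S T : PROP) := MkPROPmor {
  mor : forall n m, S n m -> T n m;
  mor_id : forall n, mor (idp n) = idp n;
  mor_comp : forall n m k (f : S n m) (g : S m k),
    mor (hcomp f g) = hcomp (mor f) (mor g);
  mor_tens : forall n m n' m' (f : S n m) (g : S n' m'),
    mor (tens f g) = tens (mor f) (mor g);
  mor_sym : forall n m, mor (sym n m) = sym n m
}.

Definition is_PROPiso (S T : PROP) (F : PROPmor S T) : Prop :=
  forall n m, bijective (@mor S T F n m).

(** * Permutations *)

(* Words for the arrows of the PROP P of permutations, the initial PROP:
   composites and tensors of identities and symmetries.  [psem T] is the action
   on words of the unique PROP morphism from P to T. *)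
Inductive pword : nat -> nat -> Type :=
  | p_id n : pword n n
  | p_sym n m : pword (n + m) (m + n)
  | p_comp n m k : pword n m -> pword m k -> pword n k
  | p_tens n m n' m' : pword n m -> pword n' m' -> pword (n + n') (m + m').

Fixpoint psem (T : PROP) n m (p : pword n m) : T n m :=
  match p in pword n m return T n m with
  | p_id n => idp n
  | p_sym n m => sym n m
  | p_comp _ _ _ p q => hcomp (psem T p) (psem T q)
  | p_tens _ _ _ _ p q => tens (psem T p) (psem T q)
  end.
Arguments psem T {n m} p.

Fixpoint pinv n m (p : pword n m) : pword m n :=
  match p in pword n m return pword m n with
  | p_id n => p_id n
  | p_sym n m => p_sym m n
  | p_comp _ _ _ p q => p_comp (pinv q) (pinv p)
  | p_tens _ _ _ _ p q => p_tens (pinv p) (pinv q)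
  end.

Lemma psemV (T : PROP) n m (p : pword n m) :
  hcomp (psem T p) (psem T (pinv p)) = idp n.
Proof.
elim: p => {n m} [n|n m|n m k p IHp q IHq|n m n' m' p IHp q IHq] /=.
- exact: hcomp1f.
- exact: symK.
- by rewrite hcompA -(hcompA _ (psem T q)) IHq hcompf1.
- by rewrite -tens_comp IHp IHq tens_id.
Qed.

Lemma psemVl (T : PROP) n m (p : pword n m) :
  hcomp (psem T (pinv p)) (psem T p) = idp m.
Proof.
elim: p => {n m} [n|n m|n m k p IHp q IHq|n m n' m' p IHp q IHq] /=.
- exact: hcomp1f.
- exact: symK.
- by rewrite hcompA -(hcompA _ (psem T (pinv p))) IHp hcompf1.
- by rewrite -tens_comp IHp IHq tens_id.
Qed.

(** * The composite profunctor S;T over the PROP of permutations *)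

Section Seq.
Variables S T : PROP.

Record cpair (n m : nat) := CPair {
  cmid : nat;
  cfst : S n cmid;
  csnd : T cmid m
}.

(* (f, p;g) ~ (f;p, g) for p a permutation; as permutations are invertible
   this is already an equivalence relation. *)
Definition cpair_rel n m (x y : cpair n m) : Prop :=
  exists p : pword (cmid x) (cmid y),
    hcomp (cfst x) (psem S p) = cfst y /\ csnd x = hcomp (psem T p) (csnd y).

Lemma cpair_rel_equiv n m : Equivalence (@cpair_rel n m).
Proof.
split.
- by move=> x; exists (p_id _); rewrite /= hcompf1 hcomp1f.
- move=> x y [p [e1 e2]]; exists (pinv p); split.
    by rewrite -e1 -hcompA psemV hcompf1.
  by rewrite e2 hcompA psemVl hcomp1f.
- move=> x y z [p [e1 e2]] [q [e3 e4]]; exists (p_comp p q) => /=; split.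
    by rewrite hcompA e1 e3.
  by rewrite e2 e4 hcompA.
Qed.

Definition Seq (n m : nat) : Type := quot (@cpair_rel_equiv n m).

Definition seq2 n k m (f : S n k) (g : T k m) : Seq n m :=
  qcls (cpair_rel_equiv n m) (CPair f g).

Lemma seq2_surj n m (x : Seq n m) :
  exists k (f : S n k) (g : T k m), x = seq2 f g.
Proof.
exists _, (cfst (qrep x)), (csnd (qrep x)).
by rewrite /seq2 -[LHS]qrepK; case: (qrep x).
Qed.

Lemma seq2P n k l m (f : S n k) (g : T k m) (f' : S n l) (g' : T l m) :
  seq2 f g = seq2 f' g' <->
  exists p : pword k l, hcomp f (psem S p) = f' /\ g = hcomp (psem T p) g'.
Proof. exact: qclsP. Qed.

Lemma seq2_balance n k l m (f : S n k) (p : pword k l) (g : T l m) :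
  seq2 f (hcomp (psem T p) g) = seq2 (hcomp f (psem S p)) g.
Proof. by apply/seq2P; exists p. Qed.

Lemma seq2_cast n n' k k' m m' (en : n = n') (ek : k = k') (em : m = m')
    (f : S n k) (g : T k m) :
  hcast en em (seq2 f g) = seq2 (hcast en ek f) (hcast ek em g).
Proof. by case: _ / en; case: _ / ek; case: _ / em. Qed.

End Seq.

Arguments seq2 {S T n k m} f g.

(** * Distributive laws of PROPs *)

(* A distributive law between the monads S and T on P in the bicategory of
   profunctors internal to monoids.  The two unit and the two multiplication
   axioms are Beck's, written on representatives; [dl_tens] says that the
   2-cell is monoidal.  Compatibility with the two actions of P is a
   consequence: see [dl_actl] and [dl_actr]. *)
Record distlaw (S T : PROP) := MkDistlaw {
  dl : forall n m, Seq S T n m -> Seq T S n m;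
  dl_idl : forall n m (g : T n m), dl (seq2 (idp n) g) = seq2 g (idp m);
  dl_idr : forall n m (f : S n m), dl (seq2 f (idp m)) = seq2 (idp n) f;
  dl_compl : forall n a b m k l (f : S n a) (f' : S a b) (g : T b m)
      (g1 : T a k) (f1 : S k m) (g2 : T n l) (f2 : S l k),
    dl (seq2 f' g) = seq2 g1 f1 -> dl (seq2 f g1) = seq2 g2 f2 ->
    dl (seq2 (hcomp f f') g) = seq2 g2 (hcomp f2 f1);
  dl_compr : forall n a b m k l (f : S n a) (g : T a b) (g' : T b m)
      (g1 : T n k) (f1 : S k b) (g2 : T k l) (f2 : S l m),
    dl (seq2 f g) = seq2 g1 f1 -> dl (seq2 f1 g') = seq2 g2 f2 ->
    dl (seq2 f (hcomp g g')) = seq2 (hcomp g1 g2) f2;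
  dl_tens : forall n l m k n' l' m' k'
      (f : S n l) (g : T l m) (g1 : T n k) (f1 : S k m)
      (f' : S n' l') (g' : T l' m') (g1' : T n' k') (f1' : S k' m'),
    dl (seq2 f g) = seq2 g1 f1 -> dl (seq2 f' g') = seq2 g1' f1' ->
    dl (seq2 (tens f f') (tens g g')) = seq2 (tens g1 g1') (tens f1 f1')
}.

Section Composite.
Variables (S T : PROP) (lam : distlaw S T).

Lemma dl_actl n a l m k (p : pword n a) (f : S a l) (g : T l m)
    (g1 : T a k) (f1 : S k m) :
  dl lam (seq2 f g) = seq2 g1 f1 ->
  dl lam (seq2 (hcomp (psem S p) f) g) = seq2 (hcomp (psem T p) g1) f1.
Proof.
move=> e; rewrite -[f1 in RHS]hcomp1f; apply: dl_compl e _.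
by rewrite -(dl_idl lam) -[psem S p in LHS]hcomp1f -seq2_balance.
Qed.

Lemma dl_actr n l b m k (f : S n l) (g : T l b) (p : pword b m)
    (g1 : T n k) (f1 : S k b) :
  dl lam (seq2 f g) = seq2 g1 f1 ->
  dl lam (seq2 f (hcomp g (psem T p))) = seq2 g1 (hcomp f1 (psem S p)).
Proof.
move=> e; rewrite -[g1 in RHS]hcompf1; apply: dl_compr e _.
by rewrite -(dl_idr lam) -[psem T p in LHS]hcompf1 seq2_balance.
Qed.

Definition ccomp n m k (x : Seq T S n m) (y : Seq T S m k) : Seq T S n k :=
  let x' := qrep x in let y' := qrep y in
  let z' := qrep (dl lam (seq2 (csnd x') (cfst y'))) in
  seq2 (hcomp (cfst x') (cfst z')) (hcomp (csnd z') (csnd y')).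

Lemma ccompE n a m b k c (f : T n a) (f' : S a m) (g : T m b) (g' : S b k)
    (h : T a c) (h' : S c b) :
  dl lam (seq2 f' g) = seq2 h h' ->
  ccomp (seq2 f f') (seq2 g g') = seq2 (hcomp f h) (hcomp h' g').
Proof.
move=> e; rewrite /ccomp /seq2.
have [] := qrep_cls (cpair_rel_equiv T S n m) (CPair f f').
have [] := qrep_cls (cpair_rel_equiv T S m k) (CPair g g').
case: (qrep _) => b0 g0 g0' q /= [eq1 ->].
case: (qrep _) => a0 f0 f0' p /= [<- ->].
have e0 := dl_actl p (dl_actr (pinv q) e).
rewrite -eq1 -hcompA psemV hcompf1 in e0.
have : qcls (cpair_rel_equiv T S a0 b0)
    (qrep (dl lam (seq2 (hcomp (psem S p) f') g0))) =
  seq2 (hcomp (psem T p) h) (hcomp h' (psem S (pinv q))) by rewrite qrepK.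
case: (qrep _) => c0 z z' /seq2P /= [r [er ->]].
apply/seq2P; exists r; split; first by rewrite -hcompA er hcompA.
by rewrite -!hcompA; congr hcomp; congr hcomp; rewrite hcompA psemVl hcomp1f.
Qed.

Definition ctens n m n' m' (x : Seq T S n m) (y : Seq T S n' m') :
    Seq T S (n + n') (m + m') :=
  let x' := qrep x in let y' := qrep y in
  seq2 (tens (cfst x') (cfst y')) (tens (csnd x') (csnd y')).

Lemma ctensE n k m n' k' m' (f : T n k) (g : S k m) (f' : T n' k')
    (g' : S k' m') :
  ctens (seq2 f g) (seq2 f' g') = seq2 (tens f f') (tens g g').
Proof.
rewrite /ctens /seq2.
have [] := qrep_cls (cpair_rel_equiv T S n m) (CPair f g).
have [] := qrep_cls (cpair_rel_equiv T S n' m') (CPair f' g').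
case: (qrep _) => b0 g0 g0' q /= [<- ->].
case: (qrep _) => a0 f0 f0' p /= [<- ->].
apply/seq2P; exists (p_tens p q) => /=.
by rewrite !tens_comp.
Qed.

Definition cincT n m (f : T n m) : Seq T S n m := seq2 f (idp m).
Definition cincS n m (f : S n m) : Seq T S n m := seq2 (idp n) f.

Lemma cincT_comp n m k (f : T n m) (g : T m k) :
  cincT (hcomp f g) = ccomp (cincT f) (cincT g).
Proof. by rewrite (ccompE f _ (dl_idl lam g)) hcomp1f. Qed.

Lemma cincS_comp n m k (f : S n m) (g : S m k) :
  cincS (hcomp f g) = ccomp (cincS f) (cincS g).
Proof. by rewrite (ccompE _ g (dl_idr lam f)) hcomp1f. Qed.

Lemma cincT_tens n m n' m' (f : T n m) (g : T n' m') :
  cincT (tens f g) = ctens (cincT f) (cincT g).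
Proof. by rewrite ctensE tens_id. Qed.

Lemma cincS_tens n m n' m' (f : S n m) (g : S n' m') :
  cincS (tens f g) = ctens (cincS f) (cincS g).
Proof. by rewrite ctensE tens_id. Qed.

Lemma cincT_cast n n' m m' (en : n = n') (em : m = m') (f : T n m) :
  cincT (hcast en em f) = hcast en em (cincT f).
Proof. by case: _ / en; case: _ / em. Qed.

Lemma cinc_perm n m (p : pword n m) : cincS (psem S p) = cincT (psem T p).
Proof.
by rewrite /cincS /cincT -[psem S p]hcompf1 seq2_balance hcomp1f.
Qed.

Definition cid n : Seq T S n n := cincT (idp n).
Definition csym n m : Seq T S (n + m) (m + n) := cincT (sym n m).

Lemma ccompA n m k l (x : Seq T S n m) (y : Seq T S m k) (z : Seq T S k l) :
  ccomp x (ccomp y z) = ccomp (ccomp x y) z.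
Proof.
have [a [a2 [a1 ->]]] := seq2_surj x.
have [b [b2 [b1 ->]]] := seq2_surj y.
have [c [c2 [c1 ->]]] := seq2_surj z.
have [d [d2 [d1 ed]]] := seq2_surj (dl lam (seq2 a1 b2)).
have [e [e2 [e1 ee]]] := seq2_surj (dl lam (seq2 b1 c2)).
have [u [u2 [u1 eu]]] := seq2_surj (dl lam (seq2 d1 e2)).
rewrite (ccompE b2 c1 ee) (ccompE a2 b1 ed).
rewrite (ccompE _ _ (dl_compr ed eu)) (ccompE _ _ (dl_compl ee eu)).
by rewrite !hcompA.
Qed.

Lemma ccomp1f n m (x : Seq T S n m) : ccomp (cid n) x = x.
Proof.
have [a [a2 [a1 ->]]] := seq2_surj x.
by rewrite (ccompE _ _ (dl_idl lam a2)) !hcomp1f.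
Qed.

Lemma ccompf1 n m (x : Seq T S n m) : ccomp x (cid m) = x.
Proof.
have [a [a2 [a1 ->]]] := seq2_surj x.
by rewrite (ccompE _ _ (dl_idr lam a1)) !hcompf1.
Qed.

Lemma ctens_id n m : ctens (cid n) (cid m) = cid (n + m).
Proof. by rewrite -cincT_tens tens_id. Qed.

Lemma ctens_comp n m k n' m' k' (f : Seq T S n m) (g : Seq T S m k)
    (f' : Seq T S n' m') (g' : Seq T S m' k') :
  ctens (ccomp f g) (ccomp f' g') = ccomp (ctens f f') (ctens g g').
Proof.
have [a [a2 [a1 ->]]] := seq2_surj f.
have [b [b2 [b1 ->]]] := seq2_surj g.
have [c [c2 [c1 ->]]] := seq2_surj f'.
have [d [d2 [d1 ->]]] := seq2_surj g'.
have [u [u2 [u1 eu]]] := seq2_surj (dl lam (seq2 a1 b2)).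
have [v [v2 [v1 ev]]] := seq2_surj (dl lam (seq2 c1 d2)).
rewrite (ccompE _ _ eu) (ccompE _ _ ev) !ctensE (ccompE _ _ (dl_tens eu ev)).
by rewrite !tens_comp.
Qed.

Lemma ctensA n m n' m' n'' m''
    (f : Seq T S n m) (g : Seq T S n' m') (h : Seq T S n'' m'') :
  hcast (addnA n n' n'') (addnA m m' m'') (ctens f (ctens g h)) =
  ctens (ctens f g) h.
Proof.
have [a [a2 [a1 ->]]] := seq2_surj f.
have [b [b2 [b1 ->]]] := seq2_surj g.
have [c [c2 [c1 ->]]] := seq2_surj h.
by rewrite !ctensE (seq2_cast _ (addnA a b c)) !tensA.
Qed.

Lemma ctens0f n m (f : Seq T S n m) : ctens (cid 0) f = f :> Seq T S n m.
Proof.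
have [a [a2 [a1 ->]]] := seq2_surj f.
by rewrite ctensE !tens0f.
Qed.

Lemma ctensf0 n m (f : Seq T S n m) :
  hcast (addn0 n) (addn0 m) (ctens f (cid 0)) = f.
Proof.
have [a [a2 [a1 ->]]] := seq2_surj f.
by rewrite ctensE (seq2_cast _ (addn0 a)) !tensf0.
Qed.

Lemma csym_nat n m n' m' (f : Seq T S n m) (g : Seq T S n' m') :
  ccomp (ctens f g) (csym m m') = ccomp (csym n n') (ctens g f).
Proof.
have [a [a2 [a1 ->]]] := seq2_surj f.
have [b [b2 [b1 ->]]] := seq2_surj g.
rewrite !ctensE.
rewrite -[csym m m'](cinc_perm (p_sym m m')) /cincS.
rewrite (ccompE _ _ (dl_idr lam _)) (ccompE _ _ (dl_idl lam _)).
rewrite hcompf1 hcomp1f /= sym_nat.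
by rewrite -(sym_nat a2 b2) (seq2_balance _ (p_sym a b)).
Qed.

Lemma csymK n m : ccomp (csym n m) (csym m n) = cid (n + m).
Proof. by rewrite -cincT_comp symK. Qed.

Lemma csym_hex n m k :
  csym n (m + k) =
  ccomp (hcast (esym (addnA n m k)) (erefl _) (ctens (csym n m) (cid k)))
        (hcast (addnA m n k) (addnA m k n) (ctens (cid m) (csym n k))).
Proof.
by rewrite /csym /cid -!cincT_tens -!cincT_cast -cincT_comp -sym_hex.
Qed.

Definition composite : PROP :=
  MkPROP ccompA ccomp1f ccompf1 ctens_id ctens_comp ctensA ctens0f ctensf0
    csym_nat csymK csym_hex.

Definition inclT : PROPmor T composite :=
  @MkPROPmor T composite cincT (fun=> erefl) cincT_comp cincT_tens
    (fun _ _ => erefl).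

Definition inclS : PROPmor S composite :=
  @MkPROPmor S composite cincS (fun=> erefl) cincS_comp cincS_tens
    (fun n m => cinc_perm (p_sym n m)).

End Composite.

(** * dagger-PROPs presented by generators and equations *)

Section Terms.
Variable Sg : nat -> nat -> Type.

Inductive term : nat -> nat -> Type :=
  | t_gen n m : Sg n m -> term n m
  | t_id n : term n n
  | t_comp n m k : term n m -> term m k -> term n k
  | t_tens n m n' m' : term n m -> term n' m' -> term (n + n') (m + m')
  | t_sym n m : term (n + m) (m + n)
  | t_dag n m : term n m -> term m n.

Variable E : forall n m, term n m -> term n m -> Prop.

(* The least dagger-PROP congruence containing E. *)
Inductive tcong : forall n m, term n m -> term n m -> Prop :=
  | tc_ax n m (f g : term n m) : E f g -> tcong f g
  | tc_refl n m (f : term n m) : tcong f f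
  | tc_symm n m (f g : term n m) : tcong f g -> tcong g f
  | tc_trans n m (f g h : term n m) : tcong f g -> tcong g h -> tcong f h
  | tc_comp n m k (f f' : term n m) (g g' : term m k) :
      tcong f f' -> tcong g g' -> tcong (t_comp f g) (t_comp f' g')
  | tc_tens n m n' m' (f f' : term n m) (g g' : term n' m') :
      tcong f f' -> tcong g g' -> tcong (t_tens f g) (t_tens f' g')
  | tc_dag n m (f f' : term n m) :
      tcong f f' -> tcong (t_dag f) (t_dag f')
  | tc_compA n m k l (f : term n m) (g : term m k) (h : term k l) :
      tcong (t_comp f (t_comp g h)) (t_comp (t_comp f g) h)
  | tc_comp1f n m (f : term n m) : tcong (t_comp (t_id n) f) f
  | tc_compf1 n m (f : term n m) : tcong (t_comp f (t_id m)) f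
  | tc_tens_id n m : tcong (t_tens (t_id n) (t_id m)) (t_id (n + m))
  | tc_tens_comp n m k n' m' k' (f : term n m) (g : term m k)
      (f' : term n' m') (g' : term m' k') :
      tcong (t_tens (t_comp f g) (t_comp f' g'))
            (t_comp (t_tens f f') (t_tens g g'))
  | tc_tensA n m n' m' n'' m''
      (f : term n m) (g : term n' m') (h : term n'' m'') :
      tcong (hcast (addnA n n' n'') (addnA m m' m'') (t_tens f (t_tens g h)))
            (t_tens (t_tens f g) h)
  | tc_tens0f n m (f : term n m) : @tcong n m (t_tens (t_id 0) f) f
  | tc_tensf0 n m (f : term n m) :
      tcong (hcast (addn0 n) (addn0 m) (t_tens f (t_id 0))) f
  | tc_sym_nat n m n' m' (f : term n m) (g : term n' m') :
      tcong (t_comp (t_tens f g) (t_sym m m'))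
            (t_comp (t_sym n n') (t_tens g f))
  | tc_symK n m : tcong (t_comp (t_sym n m) (t_sym m n)) (t_id (n + m))
  | tc_sym_hex n m k :
      tcong (t_sym n (m + k))
        (t_comp (hcast (esym (addnA n m k)) (erefl _)
                   (t_tens (t_sym n m) (t_id k)))
                (hcast (addnA m n k) (addnA m k n)
                   (t_tens (t_id m) (t_sym n k))))
  | tc_dagK n m (f : term n m) : tcong (t_dag (t_dag f)) f
  | tc_dag_id n : tcong (t_dag (t_id n)) (t_id n)
  | tc_dag_comp n m k (f : term n m) (g : term m k) :
      tcong (t_dag (t_comp f g)) (t_comp (t_dag g) (t_dag f))
  | tc_dag_tens n m n' m' (f : term n m) (g : term n' m') :
      tcong (t_dag (t_tens f g)) (t_tens (t_dag f) (t_dag g))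
  | tc_dag_sym n m : tcong (t_dag (t_sym n m)) (t_sym m n).

Lemma tcong_equiv n m : Equivalence (@tcong n m).
Proof.
by split; [exact: tc_refl | exact: tc_symm | move=> ? ? ?; exact: tc_trans].
Qed.

Definition phom (n m : nat) : Type := quot (@tcong_equiv n m).
Definition pcls n m (t : term n m) : phom n m := qcls (tcong_equiv n m) t.

Lemma pclsP n m (t u : term n m) : pcls t = pcls u <-> tcong t u.
Proof. exact: qclsP. Qed.

Lemma pcls_surj n m (f : phom n m) : exists t, f = pcls t.
Proof. by exists (qrep f); rewrite /pcls qrepK. Qed.

Lemma pcls_cast n n' m m' (en : n = n') (em : m = m') (t : term n m) :
  hcast en em (pcls t) = pcls (hcast en em t).
Proof. by case: _ / en; case: _ / em. Qed.

Definition pcomp n m k (f : phom n m) (g : phom m k) : phom n k :=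
  pcls (t_comp (qrep f) (qrep g)).
Definition ptens n m n' m' (f : phom n m) (g : phom n' m') :
    phom (n + n') (m + m') :=
  pcls (t_tens (qrep f) (qrep g)).
Definition pdag n m (f : phom n m) : phom m n := pcls (t_dag (qrep f)).

Lemma pcompE n m k (f : term n m) (g : term m k) :
  pcomp (pcls f) (pcls g) = pcls (t_comp f g).
Proof. by apply/pclsP/tc_comp; apply: qrep_cls. Qed.

Lemma ptensE n m n' m' (f : term n m) (g : term n' m') :
  ptens (pcls f) (pcls g) = pcls (t_tens f g).
Proof. by apply/pclsP/tc_tens; apply: qrep_cls. Qed.

Lemma pdagE n m (f : term n m) : pdag (pcls f) = pcls (t_dag f).
Proof. by apply/pclsP/tc_dag; apply: qrep_cls. Qed.

Definition presented_PROP : PROP.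
Proof.
refine (@MkPROP phom (fun n => pcls (t_id n)) pcomp ptens
  (fun n m => pcls (t_sym n m)) _ _ _ _ _ _ _ _ _ _ _).
- move=> n m k l f g h.
  have [f' ->] := pcls_surj f; have [g' ->] := pcls_surj g.
  have [h' ->] := pcls_surj h.
  by rewrite !pcompE; apply/pclsP/tc_compA.
- by move=> n m f; have [f' ->] := pcls_surj f; rewrite pcompE;
    apply/pclsP/tc_comp1f.
- by move=> n m f; have [f' ->] := pcls_surj f; rewrite pcompE;
    apply/pclsP/tc_compf1.
- by move=> n m; rewrite ptensE; apply/pclsP/tc_tens_id.
- move=> n m k n' m' k' f g h i.
  have [f' ->] := pcls_surj f; have [g' ->] := pcls_surj g.
  have [h' ->] := pcls_surj h; have [i' ->] := pcls_surj i.
  by rewrite (pcompE f') (pcompE h') !ptensE pcompE; apply/pclsP/tc_tens_comp.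
- move=> n m n' m' n'' m'' f g h.
  have [f' ->] := pcls_surj f; have [g' ->] := pcls_surj g.
  have [h' ->] := pcls_surj h.
  by rewrite !ptensE pcls_cast; apply/pclsP/tc_tensA.
- by move=> n m f; have [f' ->] := pcls_surj f; rewrite ptensE;
    apply/pclsP/tc_tens0f.
- by move=> n m f; have [f' ->] := pcls_surj f; rewrite ptensE pcls_cast;
    apply/pclsP/tc_tensf0.
- move=> n m n' m' f g.
  have [f' ->] := pcls_surj f; have [g' ->] := pcls_surj g.
  by rewrite !ptensE !pcompE; apply/pclsP/tc_sym_nat.
- by move=> n m; rewrite pcompE; apply/pclsP/tc_symK.
- by move=> n m k; rewrite !ptensE !pcls_cast pcompE; apply/pclsP/tc_sym_hex.
Defined.

Definition presented : dPROP.
Proof.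
refine (@MkdPROP presented_PROP pdag _ _ _ _ _).
- by move=> n m f; have [f' ->] := pcls_surj f; rewrite !pdagE;
    apply/pclsP/tc_dagK.
- by move=> n; rewrite [LHS]pdagE; apply/pclsP/tc_dag_id.
- move=> n m k f g /=.
  have [f' ->] := pcls_surj f; have [g' ->] := pcls_surj g.
  by rewrite pcompE !pdagE pcompE; apply/pclsP/tc_dag_comp.
- move=> n m n' m' f g /=.
  have [f' ->] := pcls_surj f; have [g' ->] := pcls_surj g.
  by rewrite ptensE !pdagE ptensE; apply/pclsP/tc_dag_tens.
- by move=> n m; rewrite [LHS]pdagE; apply/pclsP/tc_dag_sym.
Defined.

End Terms.

Arguments t_id {Sg} n.
Arguments t_sym {Sg} n m.

Section TermMap.
Variables (A B : nat -> nat -> Type) (h : forall n m, A n m -> B n m).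

Fixpoint tmap n m (t : term A n m) : term B n m :=
  match t in term _ n m return term B n m with
  | t_gen _ _ a => t_gen (h a)
  | t_id n => t_id n
  | t_comp _ _ _ f g => t_comp (tmap f) (tmap g)
  | t_tens _ _ _ _ f g => t_tens (tmap f) (tmap g)
  | t_sym n m => t_sym n m
  | t_dag _ _ f => t_dag (tmap f)
  end.

Lemma tmap_cast n n' m m' (en : n = n') (em : m = m') (t : term A n m) :
  tmap (hcast en em t) = hcast en em (tmap t).
Proof. by case: _ / en; case: _ / em. Qed.

Variables (E : forall n m, term A n m -> term A n m -> Prop)
  (F : forall n m, term B n m -> term B n m -> Prop).
Hypothesis hE : forall n m (t u : term A n m),
  E t u -> tcong F (tmap t) (tmap u).

Lemma tmap_cong n m (t u : term A n m) :
  tcong E t u -> tcong F (tmap t) (tmap u).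
Proof.
elim=> {n m t u} /=; intros; rewrite ?tmap_cast /=;
  by [apply: hE | econstructor; eassumption | constructor].
Qed.

Definition presented_map_fun n m (f : phom E n m) : phom F n m :=
  pcls F (tmap (qrep f)).

Lemma presented_map_funE n m (t : term A n m) :
  presented_map_fun (pcls E t) = pcls F (tmap t).
Proof. by apply/pclsP/tmap_cong; apply: qrep_cls. Qed.

Definition presented_map : PROPmor (presented E) (presented F).
Proof.
refine (@MkPROPmor (presented E) (presented F) presented_map_fun _ _ _ _).
- by move=> n; rewrite [LHS]presented_map_funE.
- move=> n m k f g.
  have [f' ->] := pcls_surj f; have [g' ->] := pcls_surj g.
  change (presented_map_fun (pcomp (pcls E f') (pcls E g')) =
    pcomp (presented_map_fun (pcls E f')) (presented_map_fun (pcls E g'))).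
  by rewrite pcompE !presented_map_funE pcompE.
- move=> n m n' m' f g.
  have [f' ->] := pcls_surj f; have [g' ->] := pcls_surj g.
  change (presented_map_fun (ptens (pcls E f') (pcls E g')) =
    ptens (presented_map_fun (pcls E f')) (presented_map_fun (pcls E g'))).
  by rewrite ptensE !presented_map_funE ptensE.
- by move=> n m; rewrite [LHS]presented_map_funE.
Defined.

End TermMap.

(** * The dagger-PROP FG of a Frobenius algebra with phase group G *)

Section FG.
Variable G : zmodType.

Inductive Fsig : nat -> nat -> Type :=
  | g_mu : Fsig 2 1
  | g_eta : Fsig 0 1
  | g_delta : Fsig 1 2
  | g_eps : Fsig 1 0
  | g_ph of G : Fsig 1 1.

Let mu : term Fsig 2 1 := t_gen g_mu.
Let eta : term Fsig 0 1 := t_gen g_eta.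
Let delta : term Fsig 1 2 := t_gen g_delta.
Let eps : term Fsig 1 0 := t_gen g_eps.
Let ph (g : G) : term Fsig 1 1 := t_gen (g_ph g).
Let id1 : term Fsig 1 1 := t_id 1.

(* The group law of G is written additively. *)
Inductive Feq : forall n m, term Fsig n m -> term Fsig n m -> Prop :=
  | F_dag_mu : Feq (t_dag mu) delta
  | F_dag_eta : Feq (t_dag eta) eps
  | F_dag_ph g : Feq (t_dag (ph g)) (ph (- g)%R)
  | F_muA : @Feq 3 1 (t_comp (t_tens mu id1) mu) (t_comp (t_tens id1 mu) mu)
  | F_mul1 : @Feq 1 1 (t_comp (t_tens eta id1) mu) id1
  | F_mur1 : @Feq 1 1 (t_comp (t_tens id1 eta) mu) id1
  | F_muC : @Feq 2 1 (t_comp (t_sym 1 1) mu) mu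
  | F_deltaA :
      @Feq 1 3 (t_comp delta (t_tens delta id1))
               (t_comp delta (t_tens id1 delta))
  | F_deltal1 : @Feq 1 1 (t_comp delta (t_tens eps id1)) id1
  | F_deltar1 : @Feq 1 1 (t_comp delta (t_tens id1 eps)) id1
  | F_deltaC : @Feq 1 2 (t_comp delta (t_sym 1 1)) delta
  | F_frobl :
      @Feq 2 2 (t_comp (t_tens id1 delta) (t_tens mu id1)) (t_comp mu delta)
  | F_frobr :
      @Feq 2 2 (t_comp mu delta) (t_comp (t_tens delta id1) (t_tens id1 mu))
  | F_special : Feq (t_comp delta mu) id1
  | F_phD g g' : Feq (t_comp (ph g') (ph g)) (ph (g + g')%R)
  | F_ph0 : Feq (ph 0%R) id1
  | F_ph_mu g :
      @Feq 2 1 (t_comp mu (ph g)) (t_comp (t_tens (ph g) id1) mu)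
  | F_ph_delta g :
      @Feq 1 2 (t_comp (ph g) delta) (t_comp delta (t_tens (ph g) id1)).

Definition FPROP : dPROP := presented Feq.

End FG.

(** * The dagger-PROP IF(G, H) *)

Section IF.
Variables G H : zmodType.

Definition IFsig (n m : nat) : Type := (Fsig G n m + Fsig H n m)%type.
Definition green n m (t : term (Fsig G) n m) : term IFsig n m :=
  tmap (fun _ _ => inl) t.
Definition red n m (t : term (Fsig H) n m) : term IFsig n m :=
  tmap (fun _ _ => inr) t.

Let eta_g : term IFsig 0 1 := t_gen (inl (g_eta G)).
Let delta_g : term IFsig 1 2 := t_gen (inl (g_delta G)).
Let eps_g : term IFsig 1 0 := t_gen (inl (g_eps G)).
Let mu_r : term IFsig 2 1 := t_gen (inr (g_mu H)).
Let eta_r : term IFsig 0 1 := t_gen (inr (g_eta H)).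
Let eps_r : term IFsig 1 0 := t_gen (inr (g_eps H)).
Let id1 : term IFsig 1 1 := t_id 1.
Let scal : term IFsig 0 0 := t_comp eta_r eps_g.

(* [scal] occurs in each bialgebra law to the power making it hold for a pair of
   complementary orthonormal bases in dimension d, where scal = sqrt d. *)
Inductive IFeq : forall n m, term IFsig n m -> term IFsig n m -> Prop :=
  | IF_green n m (t u : term (Fsig G) n m) : Feq t u -> IFeq (green t) (green u)
  | IF_red n m (t u : term (Fsig H) n m) : Feq t u -> IFeq (red t) (red u)
  | IF_bialg : @IFeq 2 2
      (t_comp mu_r delta_g)
      (t_tens scal
        (t_comp (t_comp (t_tens delta_g delta_g)
                        (t_tens id1 (t_tens (t_sym 1 1) id1)))
                (t_tens mu_r mu_r)))
  | IF_copy : @IFeq 0 2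
      (t_tens scal (t_comp eta_r delta_g)) (t_tens eta_r eta_r)
  | IF_cocopy : @IFeq 2 0
      (t_tens scal (t_comp mu_r eps_g)) (t_tens eps_g eps_g)
  | IF_plus_eta : @IFeq 0 1
      eta_r (t_comp (t_comp eta_g delta_g) (t_tens eps_r id1))
  | IF_plus_eps : @IFeq 1 0
      eps_g (t_comp (t_comp (t_tens id1 eta_g) mu_r) eps_r).

Definition IFPROP : dPROP := presented IFeq.

Definition IFgreen : PROPmor (FPROP G) IFPROP :=
  presented_map (fun n m t u e => tc_ax (IF_green e)).
Definition IFred : PROPmor (FPROP H) IFPROP :=
  presented_map (fun n m t u e => tc_ax (IF_red e)).

End IF.

(* [lam] gives rise to [Q]: its composite is isomorphic to Q as a PROP, under
   the inclusions of the two factors. *)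
Definition gives_rise_to (S T Q : PROP) (jS : PROPmor S Q) (jT : PROPmor T Q)
    (lam : distlaw S T) : Prop :=
  exists Phi : PROPmor (composite lam) Q,
    [/\ is_PROPiso Phi,
        forall n m (f : S n m), mor Phi (mor (inclS lam) f) = mor jS f &
        forall n m (f : T n m), mor Phi (mor (inclT lam) f) = mor jT f].

(* Main.v *)
Require Import Defs.
From mathcomp Require Import all_boot ssralg.

Set Implicit Arguments.
Unset Strict Implicit.
Unset Printing Implicit Defensive.

(** In the composite PROP a red-then-green factorisation is unique up to a
    permutation of the middle object.  The copy law of IF(G, H) provides two
    such factorisations of [eta_r (x) eta_r] through [2], with the same red part
    and with green parts [eps_g (x) delta_g] and [id_2].  So [eps_g (x) delta_g]
    would be a permutation, hence invertible, in FG.  It is not: interpret FG in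
    relations between bit strings, reading every generator as the spider that
    relates x and y when all bits of x and y agree; then [eps_g (x) delta_g]
    relates both 01 and 11 to 11. *)

(** An explicit enumeration of the possible middle states makes relational composition a computable
    boolean, so that the generating equations can be checked by evaluation. *)
Fixpoint bitstrings n : seq (seq bool) :=
  if n is k.+1 then [seq b :: s | b <- [:: true; false], s <- bitstrings k]
  else [:: [::]].

Lemma mem_bitstrings n z : (z \in bitstrings n) = (size z == n).
Proof.
elim: n z => [|n IH] [|b z] //=.
  by apply/negP; rewrite cats0 mem_cat => /orP[] /mapP[].
rewrite cats0 mem_cat eqSS -IH.
have injc a : injective (cons a : seq bool -> _) by move=> ? ? [].
have neqc a c s : a != c -> (a :: z \in [seq c :: s | s <- s]) = false.
  by move=> ac; apply/negP => /mapP[? _ [/eqP]]; rewrite (negPf ac).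
by case: b; rewrite mem_map ?neqc ?orbF.
Qed.

Lemma size_addP (T : Type) n m (x : seq T) : size x = n + m ->
  exists a b, [/\ x = a ++ b, size a = n & size b = m].
Proof.
move=> sx; exists (take n x), (drop n x).
by rewrite cat_take_drop size_takel ?size_drop sx ?leq_addr // addKn.
Qed.

Section SpiderSemantics.
Variable Sg : nat -> nat -> Type.

(** Plain lists rather than tuples of fixed length keep the transports [hcast] invisible to the
    semantics. Values on strings of the wrong length carry no meaning. A phase, being a spider with
    two legs, becomes the identity relation. *)
Fixpoint spider n m (t : term Sg n m) (x y : seq bool) : bool :=
  match t with
  | t_gen _ _ _ => constant (x ++ y)
  | t_id _ => x == y
  | t_comp _ k _ f g => has (fun z => spider f x z && spider g z y) (bitstrings k)
  | t_tens n m _ _ f g =>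
      spider f (take n x) (take m y) && spider g (drop n x) (drop m y)
  | t_sym n _ => y == drop n x ++ take n x
  | t_dag _ _ f => spider f y x
  end.

Lemma spider_cast n n' m m' (en : n = n') (em : m = m') (t : term Sg n m) :
  spider (hcast en em t) = spider t.
Proof. by case: _ / en; case: _ / em. Qed.

Lemma spider_compP n m k (f : term Sg n m) (g : term Sg m k) x y :
  reflect (exists z, [/\ size z = m, spider f x z & spider g z y])
          (spider (t_comp f g) x y).
Proof.
apply: (iffP hasP) => [[z]|[z [sz fxz gzy]]].
  by rewrite mem_bitstrings => /eqP sz /andP[fxz gzy]; exists z.
by exists z; [rewrite mem_bitstrings sz | apply/andP].
Qed.

Lemma spider_tens n m n' m' (f : term Sg n m) (g : term Sg n' m') x y x' y' :
  size x = n -> size y = m ->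
  spider (t_tens f g) (x ++ x') (y ++ y') = spider f x y && spider g x' y'.
Proof. by move=> sx sy /=; rewrite !take_size_cat ?drop_size_cat. Qed.

Lemma spider_sym n m x x' y : size x = n ->
  spider (@t_sym Sg n m) (x ++ x') y = (y == x' ++ x).
Proof. by move=> sx /=; rewrite take_size_cat ?drop_size_cat. Qed.

Variable E : forall n m, term Sg n m -> term Sg n m -> Prop.
Hypothesis spiderE : forall n m (t u : term Sg n m), E t u ->
  forall x y, size x = n -> size y = m -> spider t x y = spider u x y.

(** Relations between bit strings form a dagger-PROP, with concatenation as tensor and converse as
    dagger, so every congruence rule is sound. The unit laws already require the size conditions:
    composition only passes through strings of the declared length, while [t_id] relates equal
    strings of any length. *)
Lemma spider_cong n m (t u : term Sg n m) : tcong E t u ->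
  forall x y, size x = n -> size y = m -> spider t x y = spider u x y.
Proof.
elim=> {n m t u}.
- exact: spiderE.
- by [].
- by move=> n m f g _ IH x y sx sy; rewrite IH.
- by move=> n m f g h _ IHf _ IHg x y sx sy; rewrite IHf ?IHg.
- move=> n m k f f' g g' _ IHf _ IHg x y sx sy.
  apply/spider_compP/spider_compP => -[z [sz fz gz]]; exists z.
    by rewrite -IHf // -IHg.
  by rewrite IHf // IHg.
- move=> n m n' m' f f' g g' _ IHf _ IHg _ _
    /size_addP[x [x' [-> sx sx']]] /size_addP[y [y' [-> sy sy']]].
  by rewrite !spider_tens // IHf ?IHg.
- by move=> n m f f' _ IH x y sx sy /=; rewrite IH.
- move=> n m k l f g h x y _ _; apply/spider_compP/spider_compP.
    move=> [z [sz fz /spider_compP[w [sw gw hw]]]].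
    by exists w; split=> //; apply/spider_compP; exists z.
  move=> [w [sw /spider_compP[z [sz fz gz]] hw]].
  by exists z; split=> //; apply/spider_compP; exists w.
- move=> n m f x y sx _; apply/spider_compP/idP => [[z [_ /eqP-> //]]|fxy].
  by exists x; split=> //=.
- move=> n m f x y _ sy; apply/spider_compP/idP => [[z [_ ? /eqP<- //]]|fxy].
  by exists y; split=> //=.
- move=> n m _ _ /size_addP[x [x' [-> sx sx']]] /size_addP[y [y' [-> sy sy']]].
  by rewrite spider_tens //= eqseq_cat ?sx.
- move=> n m k n' m' k' f g f' g' _ _
    /size_addP[x [x' [-> sx sx']]] /size_addP[y [y' [-> sy sy']]].
  rewrite spider_tens //; apply/andP/spider_compP.
    move=> [/spider_compP[z [sz fz gz]] /spider_compP[z' [sz' fz' gz']]].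
    by exists (z ++ z'); rewrite size_cat !spider_tens // sz sz' fz fz' gz.
  move=> [_ [/size_addP[z [z' [-> sz sz']]]]].
  rewrite !spider_tens // => /andP[fz fz'] /andP[gz gz'].
  by split; apply/spider_compP; [exists z | exists z'].
- move=> n m n' m' n'' m'' f g h _ _
    /size_addP[_ [x'' [-> /size_addP[x [x' [-> sx sx']]] sx'']]]
    /size_addP[_ [y'' [-> /size_addP[y [y' [-> sy sy']]] sy'']]].
  rewrite spider_cast [RHS]spider_tens ?size_cat ?sx ?sx' ?sy ?sy' //.
  by rewrite -!catA !spider_tens // andbA.
- by move=> n m f x y _ _ /=; rewrite !take0 !drop0.
- move=> n m f x y sx sy; rewrite spider_cast -[x]cats0 -[y]cats0.
  by rewrite spider_tens // !cats0 andbT.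
- move=> n m n' m' f g _ _
    /size_addP[x [x' [-> sx sx']]] /size_addP[y [y' [-> sy sy']]].
  apply/spider_compP/spider_compP.
    move=> [_ [/size_addP[z [z' [-> sz sz']]]]].
    rewrite spider_tens // spider_sym // => /andP[fz gz].
    rewrite eqseq_cat ?sy // => /andP[/eqP-> /eqP->].
    exists (x' ++ x); rewrite size_cat sx sx' spider_sym // eqxx.
    by rewrite spider_tens // fz gz.
  move=> [z [sz]]; rewrite spider_sym // => /eqP->.
  rewrite spider_tens // => /andP[gz fz].
  by exists (y' ++ y); rewrite size_cat sy sy' spider_sym // eqxx
    spider_tens // fz gz.
- move=> n m _ y /size_addP[x [x' [-> sx sx']]] sy.
  apply/spider_compP/idP => [[z [sz]]|/eqP<-].
    rewrite spider_sym // => /eqP->; rewrite spider_sym // => /eqP->.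
    exact: eqxx.
  by exists (x' ++ x); rewrite size_cat sx sx' !spider_sym // !eqxx.
(* Hexagon: [a ++ b ++ c] goes to [b ++ c ++ a] through [b ++ a ++ c]. *)
- move=> n m k _ y /size_addP[a [_ [-> sa /size_addP[b [c [-> sb sc]]]]]] sy.
  rewrite spider_sym //; apply/eqP/spider_compP.
    move=> ->; exists (b ++ a ++ c); rewrite !spider_cast !size_cat sa sb sc.
    split; first by rewrite addnA.
      rewrite !catA spider_tens ?size_cat ?sa ?sb ?(addnC n) //.
      by rewrite spider_sym // eqxx /=.
    rewrite -!catA spider_tens // spider_sym // eqxx andbT.
    exact: eqxx.
  move=> [z [sz]]; rewrite !spider_cast.
  move: sz => /size_addP[ba [c' [-> sba sc']]].
  rewrite catA spider_tens ?size_cat ?sa ?sb // spider_sym //.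
  move=> /andP[/eqP-> /eqP<-].
  move: sy; rewrite -addnA => /size_addP[y1 [y2 [-> sy1 sy2]]].
  rewrite -!catA spider_tens // spider_sym // => /andP[/eqP<- /eqP->].
  by [].
- by [].
- by move=> n x y _ _ /=; rewrite eq_sym.
- move=> n m k f g x y _ _.
  by apply/(@spider_compP _ _ _ f g)/spider_compP => -[z [sz ? ?]]; exists z.
- by [].
- move=> n m y _ sy /size_addP[x [x' [-> sx sx']]].
  move: sy => /size_addP[y1 [y2 [-> sy1 sy2]]].
  rewrite spider_sym //= take_size_cat ?drop_size_cat //.
  by rewrite !eqseq_cat ?sy1 ?sx // andbC (eq_sym x) (eq_sym x').
Qed.

End SpiderSemantics.

Lemma spider_Feq (G : zmodType) n m (t u : term (Fsig G) n m) : Feq t u ->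
  forall x y, size x = n -> size y = m -> spider t x y = spider u x y.
Proof.
(* Each equation has at most four boundary wires, which leaves finitely many bit patterns to
   evaluate. *)
case=> {n m t u} *;
  repeat match goal with
  | x : seq bool |- _ => destruct x as [|[] x]; try discriminate
  end; by vm_compute.
Qed.

Definition Feta (G : zmodType) : FPROP G 0 1 := pcls _ (t_gen (g_eta G)).
Definition Feps (G : zmodType) : FPROP G 1 0 := pcls _ (t_gen (g_eps G)).
Definition Fdelta (G : zmodType) : FPROP G 1 2 := pcls _ (t_gen (g_delta G)).

Lemma eps_tens_delta_no_retraction (G : zmodType) (f : FPROP G 2 2) :
  hcomp (tens (Feps G) (Fdelta G)) f <> idp 2.
Proof.
have [t ->] := pcls_surj f.
rewrite /= ptensE pcompE => /pclsP/(spider_cong (@spider_Feq G)) sem_id.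
have := sem_id [:: false; true] [:: false; true] erefl erefl.
move=> /(introT eqP); rewrite [spider (t_id _) _ _]eqxx eqb_id.
move=> /spider_compP[[|a [|b [|? ?]]] [//= _ ab t01]].
(* The counit discards the first input bit, so the middle state reached from 01 is also reached from
   11; the composite then relates 11 to 01, unlike the identity. *)
have := sem_id [:: true; true] [:: false; true] erefl erefl.
by move=> /negbT/negP; apply; apply/spider_compP; exists [:: a; b].
Qed.

(** A pair is the composite of its two included components, because the law acts trivially on the
    identities between them. *)
Lemma mor_seq2 (S T Q : PROP) (lam : distlaw S T) (jS : PROPmor S Q)
    (jT : PROPmor T Q) (Phi : PROPmor (composite lam) Q) :
  (forall n m (f : S n m), mor Phi (mor (inclS lam) f) = mor jS f) ->
  (forall n m (f : T n m), mor Phi (mor (inclT lam) f) = mor jT f) ->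
  forall n k m (f : T n k) (g : S k m),
    mor Phi (seq2 f g : composite lam n m) = hcomp (mor jT f) (mor jS g).
Proof.
move=> PhiS PhiT n k m f g; rewrite -PhiS -PhiT -mor_comp /=; congr (mor Phi _).
by rewrite (ccompE _ _ (dl_idl lam (idp k))) hcompf1 hcomp1f.
Qed.

Lemma IFgreenE (G H : zmodType) n m (t : term (Fsig G) n m) :
  mor (IFgreen G H) (pcls _ t : FPROP G n m) = pcls (@IFeq G H) (green H t).
Proof. exact: (presented_map_funE (fun _ _ _ _ e => tc_ax (IF_green H e))). Qed.

Lemma IFredE (G H : zmodType) n m (t : term (Fsig H) n m) :
  mor (IFred G H) (pcls _ t : FPROP H n m) = pcls (@IFeq G H) (red G t).
Proof. exact: (presented_map_funE (fun _ _ _ _ e => tc_ax (IF_red G e))). Qed.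

(** By interchange, the scalar in [IF_copy] supplies a second [eta_r], absorbed by [eps_g]; hence
    both sides of the copy law start with the same red part 0 -> 2. *)
Lemma IF_copy_factor (G H : zmodType) :
  hcomp (mor (IFred G H) (tens (Feta H) (Feta H)))
        (mor (IFgreen G H) (tens (Feps G) (Fdelta G))) =
  hcomp (mor (IFred G H) (tens (Feta H) (Feta H)))
        (mor (IFgreen G H) (idp 2)).
Proof.
rewrite (mor_id (IFgreen G H) 2) hcompf1 !mor_tens -tens_comp.
rewrite !IFgreenE !IFredE /= !pcompE !ptensE.
exact/pclsP/tc_ax/IF_copy.
Qed.

Theorem theorem13 (G H : zmodType) :
  ~ exists tau : distlaw (FPROP G) (FPROP H),
      gives_rise_to (IFgreen G H) (IFred G H) tau.
Proof.
move=> [tau [Phi [isoPhi PhiS PhiT]]].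
have := IF_copy_factor G H; rewrite -!(mor_seq2 PhiS PhiT).
(* Injectivity of [Phi] moves the equality into the composite, where equal pairs differ by a
   permutation [p] of the middle object; its inverse would be a retraction. *)
move=> /(bij_inj (isoPhi _ _))/seq2P[p [_ eps_delta]].
apply: (@eps_tens_delta_no_retraction G (psem _ (pinv p))).
by rewrite eps_delta hcompf1 psemV.
Qed.
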